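(* Let $G$ be a graph and let $S$ and $T$ be infinite non-increasing sequences of positive integers, both realized by $G$. If $S\le T$ (that is, $s_i\le t_i$ for every index $i$), then $$\chi(G)\le\chi_S(G)\le\chi_T(G)\le\varphi_T(G)\le\varphi_S(G)\le\varphi(G)\le\Delta(G)+1.$$
   Context: Graphs are finite, simple and connected; $\chi(G)$ is the chromatic number and $\Delta(G)$ the maximum degree. Given a proper coloring of $G$, a vertex $v$ is a color-dominating vertex (CDV) if its closed neighborhood $N[v]$ contains all colors used in the coloring. A b-coloring is a proper coloring in which every color class contains at least one CDV; $\varphi(G)$ is the maximum number of colors in a b-coloring of $G$. $G$ realizes a finite sequence $(s_1,\dots,s_k)$, $k\ge 1$, if $G$ has a b-coloring with exactly $k$ colors in which, for each $i\in\{1,\dots,k\}$, the $i$th color class contains at least $s_i$ CDVs. $G$ realizes an infinite sequence $S=(s_1,s_2,\dots)$ if it realizes $(s_1,\dots,s_k)$ for at least one $k\ge 1$. The $S$-spectrum of $G$ is the set of all $k$ for which $G$ realizes $(s_1,\dots,s_k)$; if $G$ realizes $S$, then $\chi_S(G)$ and $\varphi_S(G)$ are the minimum and maximum elements of the $S$-spectrum. *)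

(* Defs.v *)
From HB Require Import structures.
From mathcomp Require Import all_boot.

Set Implicit Arguments.
Unset Strict Implicit.
Unset Printing Implicit Defensive.

Record cgraph := CGraph {
  vertex :> finType;
  adj : rel vertex;
  adj_sym : symmetric adj;
  adj_irr : irreflexive adj;
  adj_connected : forall x y : vertex, connect adj x y
}.

Definition nbh (G : cgraph) (v : G) : {set G} := [set w | adj v w].

Definition cnbh (G : cgraph) (v : G) : {set G} := v |: nbh v.

Definition max_degree (G : cgraph) : nat := \max_(v : G) #|nbh v|.

Definition proper_coloring (G : cgraph) (k : nat) (c : {ffun G -> 'I_k}) : bool :=
  [forall u, forall v, adj u v ==> (c u != c v)].

Definition colors_used (G : cgraph) (k : nat) (c : {ffun G -> 'I_k}) : {set 'I_k} :=
  [set c v | v : G].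

Definition uses_all_colors (G : cgraph) (k : nat) (c : {ffun G -> 'I_k}) : bool :=
  colors_used c == [set: 'I_k].

Definition color_class (G : cgraph) (k : nat) (c : {ffun G -> 'I_k}) (i : 'I_k)
  : {set G} := [set v | c v == i].

Definition CDV (G : cgraph) (k : nat) (c : {ffun G -> 'I_k}) : {set G} :=
  [set v | colors_used c \subset [set c w | w in cnbh v]].

Definition b_coloring (G : cgraph) (k : nat) (c : {ffun G -> 'I_k}) : bool :=
  [&& proper_coloring c, uses_all_colors c
    & [forall i, exists v in color_class c i, v \in CDV c]].

Definition colorable (G : cgraph) (k : nat) : bool :=
  [exists c : {ffun G -> 'I_k}, proper_coloring c && uses_all_colors c].

Definition b_colorable (G : cgraph) (k : nat) : bool :=
  [exists c : {ffun G -> 'I_k}, b_coloring c].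

Definition realizes (G : cgraph) (k : nat) (s : 'I_k -> nat) : bool :=
  (0 < k) &&
  [exists c : {ffun G -> 'I_k},
     b_coloring c && [forall i, s i <= #|color_class c i :&: CDV c|]].

(* An infinite sequence (s_1, s_2, ...) is a function S with S i = s_(i+1), so
   that its prefix (s_1, ..., s_k) is the restriction of S to 'I_k. *)
Definition spectrum (G : cgraph) (S : nat -> nat) : pred nat :=
  fun k => realizes G (fun i : 'I_k => S i).

Definition realizes_inf (G : cgraph) (S : nat -> nat) : Prop :=
  exists k, spectrum G S k.

Lemma colorable_exists (G : cgraph) : exists k, colorable G k.
Proof.
exists #|G|; apply/existsP; exists [ffun v => enum_rank v]; apply/andP; split.
  apply/forallP=> u; apply/forallP=> v; apply/implyP=> uv; rewrite !ffunE.
  by apply/eqP=> /enum_rank_inj E; move: uv; rewrite E adj_irr.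
apply/eqP/setP=> i; rewrite inE; apply/imsetP.
by exists (enum_val i); rewrite // ffunE enum_valK.
Qed.

Definition chromatic_number (G : cgraph) : nat := ex_minn (colorable_exists G).

Lemma b_colorable_bound (G : cgraph) (k : nat) : b_colorable G k -> k <= #|G|.
Proof.
case/existsP=> c /and3P[_ /eqP Uc _].
have := leq_imset_card c G.
by rewrite -[c @: G]/(colors_used c) Uc cardsT card_ord.
Qed.

(* A class without CDV in a coloring with k+1 colors can be eliminated. *)
Lemma recolor (G : cgraph) (k : nat) (c : {ffun G -> 'I_k.+1}) (i : 'I_k.+1) :
  proper_coloring c -> uses_all_colors c ->
  (forall v, v \in color_class c i -> v \notin CDV c) -> colorable G k.
Proof.
move=> /forallP Pc /eqP Uc Ni.
have missing v : c v = i -> exists j, j \notin [set c w | w in cnbh v].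
  move=> cv; have: v \notin CDV c by apply: Ni; rewrite inE cv.
  by rewrite inE => /subsetPn[j _ Hj]; exists j.
pose f v := if c v == i then odflt i [pick j | j \notin [set c w | w in cnbh v]]
            else c v.
have fP v : c v = i -> f v \notin [set c w | w in cnbh v].
  move=> cv; rewrite /f cv eqxx; case: pickP => //= H.
  by case: (missing v cv) => j Hj; have := H j; rewrite Hj.
have fN v : c v != i -> f v = c v by rewrite /f => /negbTE ->.
have fi v : i != f v.
  have [cv|cv] := eqVneq (c v) i; last by rewrite fN // eq_sym.
  apply: contraNneq (fP v cv) => <-; rewrite -cv imset_f // !inE eqxx //.
have fadj u v : adj u v -> c u = i -> f u != f v.
  move=> uv cu; have cv : c v != i.
    by have /forallP/(_ v) := Pc u; rewrite uv cu eq_sym.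
  rewrite (fN v cv); apply: contraNneq (fP u cu) => ->.
  by rewrite imset_f // !inE uv orbT.
pose d := [ffun v => s2val (unlift_some (fi v))] : {ffun G -> 'I_k}.
have dE v : lift i (d v) = f v by rewrite ffunE; case: (unlift_some _).
apply/existsP; exists d; apply/andP; split.
  apply/forallP=> u; apply/forallP=> v; apply/implyP=> uv.
  rewrite -(inj_eq (@lift_inj _ i)) !dE.
  have [cu|cu] := eqVneq (c u) i; first exact: fadj.
  have [cv|cv] := eqVneq (c v) i; first by rewrite eq_sym fadj // adj_sym.
  by rewrite !fN //; have /forallP/(_ v) := Pc u; rewrite uv.
apply/eqP/setP=> j; rewrite inE; apply/imsetP.
have: lift i j \in colors_used c by rewrite Uc inE.
case/imsetP=> v _ cv; exists v => //; apply: (@lift_inj _ i).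
by rewrite dE fN -cv // eq_sym neq_lift.
Qed.

Lemma b_colorable_exists (G : cgraph) : exists k, b_colorable G k.
Proof.
case: (ex_minnP (colorable_exists G)) => k /existsP[c /andP[Pc Uc]] mk.
exists k; apply/existsP; exists c; rewrite /b_coloring Pc Uc /=.
apply/forallP=> i; apply: contraT; rewrite negb_exists_in => /forall_inP Ni.
case: k => [|k] in c Pc Uc mk i Ni *; first by case: i {Ni}.
by have := mk k (recolor Pc Uc Ni); rewrite ltnn.
Qed.

Definition b_chromatic_number (G : cgraph) : nat :=
  ex_maxn (b_colorable_exists G) (@b_colorable_bound G).

Lemma spectrum_bound (G : cgraph) (S : nat -> nat) (k : nat) :
  spectrum G S k -> k <= #|G|.
Proof.
case/andP=> _ /existsP[c /andP[bc _]].
by apply: b_colorable_bound; apply/existsP; exists c.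
Qed.

Definition chi_seq (G : cgraph) (S : nat -> nat) (hS : realizes_inf G S) : nat :=
  ex_minn hS.

Definition phi_seq (G : cgraph) (S : nat -> nat) (hS : realizes_inf G S) : nat :=
  ex_maxn hS (@spectrum_bound G S).

(* Main.v *)
Require Import Defs.
From mathcomp Require Import all_boot.

(** Since [S] lies below [T], a coloring that realizes a prefix of [T] also realizes that prefix of
    [S]. So the [T]-spectrum lies in the [S]-spectrum, which lies in the set of [k] with a
    b-coloring, and that in the set of [k] with a proper coloring. Passing to a larger set lowers
    the minimum and raises the maximum, which gives every inequality but the last; that one is
    [b_colorable_max_degree]. *)

Lemma spectrum_b_colorable (G : cgraph) (S : nat -> nat) (k : nat) :
  spectrum G S k -> b_colorable G k.
Proof.
by case/andP=> _ /existsP[c /andP[bc _]]; apply/existsP; exists c.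
Qed.

Lemma b_colorable_colorable (G : cgraph) (k : nat) :
  b_colorable G k -> colorable G k.
Proof.
by case/existsP=> c /and3P[Pc Uc _]; apply/existsP; exists c; rewrite Pc.
Qed.

Lemma spectrum_le (G : cgraph) (S T : nat -> nat) (k : nat) :
  (forall i, S i <= T i) -> spectrum G T k -> spectrum G S k.
Proof.
move=> le_ST /andP[k_gt0 /existsP[c /andP[bc /forallP cT]]].
apply/andP; split=> //; apply/existsP; exists c; rewrite bc.
by apply/forallP=> i; apply: leq_trans (cT i).
Qed.

Lemma card_cnbh (G : cgraph) (v : G) : #|cnbh v| <= max_degree G + 1.
Proof.
by rewrite cardsU1 addnC leq_add ?leq_b1 // (leq_bigmax (F := fun v => #|nbh v|)).
Qed.

(** A single CDV suffices: its closed neighborhood shows all [k] colors, so it has at least [k]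
    vertices. *)
Lemma b_colorable_max_degree (G : cgraph) (k : nat) :
  b_colorable G k -> k <= max_degree G + 1.
Proof.
(* With at least one color, the class of color [ord0] supplies the CDV. *)
case: k => [//|k] /existsP[c /and3P[_ /eqP Uc /forallP/(_ ord0)]].
case/exists_inP=> v _; rewrite inE Uc => /subset_leq_card.
rewrite cardsT card_ord => /leq_trans; apply.
exact: leq_trans (leq_imset_card _ _) (card_cnbh _ _).
Qed.

Theorem proposition2p4 (G : cgraph) (S T : nat -> nat)
  (S_pos : forall i, 0 < S i) (T_pos : forall i, 0 < T i)
  (S_noninc : forall i j, i <= j -> S j <= S i)
  (T_noninc : forall i j, i <= j -> T j <= T i)
  (hS : realizes_inf G S) (hT : realizes_inf G T)
  (le_ST : forall i, S i <= T i) :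
  chromatic_number G <= chi_seq hS /\
  chi_seq hS <= chi_seq hT /\
  chi_seq hT <= phi_seq hT /\
  phi_seq hT <= phi_seq hS /\
  phi_seq hS <= b_chromatic_number G /\
  b_chromatic_number G <= max_degree G + 1.
Proof.
rewrite /chromatic_number /chi_seq /phi_seq /b_chromatic_number.
case: ex_minnP => x _ min_x; case: ex_minnP => cS S_cS min_cS.
case: ex_minnP => cT T_cT min_cT; case: ex_maxnP => pT T_pT max_pT.
case: ex_maxnP => pS S_pS max_pS; case: ex_maxnP => b b_b max_b.
(* Each extremum of a smaller set is a member of the larger one, whose own extremum then bounds
   it. *)
split; first exact/min_x/b_colorable_colorable/(spectrum_b_colorable _ _ _ S_cS).
split; first exact/min_cS/(spectrum_le _ _ _ _ le_ST).
split; first exact: min_cT.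
split; first exact/max_pS/(spectrum_le _ _ _ _ le_ST).
split; first exact/max_b/(spectrum_b_colorable _ _ _ S_pS).
exact: b_colorable_max_degree.
Qed.
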